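(* Let $\Gamma = \langle n_1, \ldots, n_k\rangle$ be a numerical monoid with minimal generators $n_1 < n_2 < \cdots < n_k$. Then $$\lim_{n \to \infty} \frac{\omega(n)}{n} = \frac{1}{n_1},$$ where the limit is taken over $n \in \Gamma$.
   Context: $\mathbb{N}$ denotes the set of non-negative integers. A numerical monoid is a co-finite additive submonoid $\Gamma$ of $\mathbb{N}$; $\Gamma = \langle n_1,\ldots,n_k\rangle$ means that $\Gamma$ is generated by $n_1,\ldots,n_k$, and the minimal generators are the irreducible elements of $\Gamma$. For $\vec a = (a_1,\ldots,a_k) \in \mathbb{N}^k$, write $|\vec a| = \sum_{i=1}^k a_i$. $\omega$-primality: for nonzero $n \in \Gamma$, $\omega(n)$ is the smallest positive integer $m$ with the property that whenever $\vec a \in \mathbb{N}^k$ satisfies $\sum_{i=1}^k a_i n_i - n \in \Gamma$ and $|\vec a| > m$, there exists $\vec b \in \mathbb{N}^k$ with $b_i \le a_i$ for each $i$ such that $\sum_{i=1}^k b_i n_i - n \in \Gamma$ and $|\vec b| \le m$; if no such $m$ exists, $\omega(n) = \infty$. Also $\omega(0) = 0$. *)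

(* Defs.v *)
From HB Require Import structures.
From mathcomp Require Import all_boot all_order all_algebra.
From mathcomp Require Import all_classical all_reals all_analysis.

Set Implicit Arguments.
Unset Strict Implicit.
Unset Printing Implicit Defensive.

Import Order.TTheory GRing.Theory Num.Theory.
Import numFieldNormedType.Exports.

Local Open Scope classical_set_scope.
Local Open Scope nat_scope.

Definition submonoid (M : set nat) : Prop :=
  M 0 /\ forall x y, M x -> M y -> M (x + y).

Definition numerical_monoid (G : set nat) : Prop :=
  submonoid G /\ finite_set (~` G).

Definition generated_by (k : nat) (gen : 'I_k -> nat) (G : set nat) : Prop :=
  G = smallest submonoid (range gen).

(* The only unit of a submonoid of nat is 0. *)
Definition irreducible_in (G : set nat) (u : nat) : Prop :=
  [/\ G u, u <> 0 &
      forall x y, G x -> G y -> u = x + y -> x = 0 \/ y = 0].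

Section Omega.
Variables (k : nat) (gen : 'I_k -> nat) (G : set nat).
Implicit Types a b : {ffun 'I_k -> nat}.

Definition vlen a : nat := \sum_(i < k) a i.

Definition vsum a : nat := \sum_(i < k) a i * gen i.

(* The difference is taken in int, because subtraction on nat is truncated. *)
Definition diff_in (s n : nat) : Prop :=
  (Posz @` G) (s%:Z - n%:Z)%R.

Definition omega_bound (n m : nat) : Prop :=
  0 < m /\
  forall a, diff_in (vsum a) n -> m < vlen a ->
    exists b, [/\ forall i, b i <= a i, diff_in (vsum b) n & vlen b <= m].

Definition omega (R : realType) (n : nat) : \bar R :=
  if n == 0 then 0%E
  else match pselect (exists m, `[< omega_bound n m >]) with
       | left bounded => ((ex_minn bounded)%:R)%:E
       | right _ => +oo%E
       end.

End Omega.

(* Main.v *)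
Require Import Defs.
From HB Require Import structures.
From mathcomp Require Import all_boot all_order all_algebra.
From mathcomp Require Import all_classical all_reals all_analysis.
From mathcomp Require Import zify.
Import Order.TTheory GRing.Theory Num.Theory.
Import numFieldNormedType.Exports.
Local Open Scope classical_set_scope.
Local Open Scope ereal_scope.

(** Write [g] for the least generator and let [c] be such that every integer
    [>= c] lies in [G]. The limit follows from the two-sided estimate
    [n <= omega n * g <= n + c + g], valid for every [n > 0]: after division
    by [n * g] both sides tend to [1 / g].

    For the lower bound, take a large multiple of the unit vector at the least
    generator, so large that its sum exceeds [n] by an element of [G]. Its subvectors are the
    smaller multiples of the same unit vector, so the short subvector provided
    by [omega] has at most [omega n] copies of [g], and their sum must reach
    [n] ([omega_bound_lower]). For the upper bound, any vector of length [m]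
    has weighted sum at least [m * g]; once [m * g >= n + c], the difference
    with [n] is so large that it lies in [G] for free, so truncating a longer
    vector to length [m] in any manner works ([omega_bound_upper]). *)

Lemma cofinite_nat_bound (G : set nat) :
  finite_set (~` G) -> exists c, forall x, (c <= x)%N -> G x.
Proof.
case/finite_seqP=> s Gs; exists (\max_(i <- s) i).+1 => x lt_s_x.
apply: contrapT => /= nGx.
have /= xs : [set` s] x by rewrite -Gs.
have := @leq_bigmax_seq _ s predT id x xs isT.
by rewrite /= leqNgt lt_s_x.
Qed.

Section OmegaBound.
Variables (k : nat) (gen : 'I_k -> nat) (G : set nat).
Implicit Types a b : {ffun 'I_k -> nat}.

Lemma diff_in_leq s n : diff_in G s n -> (n <= s)%N.
Proof. by case=> z _ zE; lia. Qed.

Lemma diff_in_large c s n :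
  (forall x, (c <= x)%N -> G x) -> (n + c <= s)%N -> diff_in G s n.
Proof. by move=> Gc le_s; exists (s - n)%N; [apply: Gc; lia | lia]. Qed.

Lemma vsum_geq g a :
  (forall i, (g <= gen i)%N) -> (vlen a * g <= vsum gen a)%N.
Proof.
by move=> g_min; rewrite /vlen big_distrl /=; apply: leq_sum => i _;
  rewrite leq_mul.
Qed.

Lemma subvector_of_length a m :
  (m <= vlen a)%N -> exists2 b : {ffun _}, (forall i, b i <= a i)%N & vlen b = m.
Proof.
elim: m => [_|m IHm lt_m_a].
  by exists [ffun=> 0%N] => [i|]; rewrite ?ffunE // /vlen big1 // => i _;
    rewrite ffunE.
have [b le_ba b_m] := IHm (ltnW lt_m_a).
have [i lt_i] : exists i, (b i < a i)%N.
  apply/existsP; apply: contraLR lt_m_a; rewrite negb_exists => /forallP le_ab.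
  rewrite -leqNgt -b_m; apply: leq_sum => i _.
  by rewrite leqNgt le_ab.
exists [ffun j => b j + (j == i)]%N => [j|].
  by rewrite ffunE; case: eqP => [->|_]; rewrite ?addn1 ?addn0.
rewrite /vlen; under eq_bigr do rewrite ffunE.
rewrite big_split /= -/(vlen b) b_m (bigD1 i) //= eqxx big1 ?addn1 //.
by move=> j /negPf ->.
Qed.

(** Only vectors supported at [i] are tested, hence the bound holds for every
    generator; the least one makes it strongest. *)
Lemma omega_bound_lower c n m i :
  (forall x, (c <= x)%N -> G x) -> (0 < gen i)%N ->
  omega_bound gen G n m -> (n <= m * gen i)%N.
Proof.
move=> Gc gi_gt0 [_ m_bound].
(* [t] copies of [gen i] are longer than [m] and sum to at least [n + c]. *)
pose t := (n + c + m).+1.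
pose a : {ffun 'I_k -> nat} := [ffun j => if j == i then t else 0%N].
have at_i (b : {ffun _}) (F : 'I_k -> nat) : (forall j, b j <= a j)%N ->
    (\sum_(j < k) b j * F j)%N = (b i * F i)%N.
  move=> le_ba; rewrite (bigD1 i) //= big1 ?addn0 // => j /negPf nji.
  by have := le_ba j; rewrite ffunE nji leqn0 => /eqP ->.
have vlenE (b : {ffun _}) : (forall j, b j <= a j)%N -> vlen b = b i.
  move=> le_ba; rewrite -[RHS]muln1 -(at_i b (fun=> 1%N)) //.
  by apply: eq_bigr => j _; rewrite muln1.
have le_aa j : (a j <= a j)%N by [].
have ai : a i = t by rewrite ffunE eqxx.
have [|| b [le_ba /diff_in_leq le_n le_m]] := m_bound a.
- apply: (diff_in_large c) => //; rewrite /vsum at_i // ai /t.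
  by apply: leq_trans (leq_pmulr _ gi_gt0); lia.
- by rewrite vlenE // ai /t; lia.
rewrite vlenE // in le_m.
by apply: leq_trans le_n _; rewrite /vsum at_i // leq_mul2r le_m orbT.
Qed.

(** Generators of size at least [g] force every vector of length [m] to have a
    sum of at least [n + c], so any truncation to that length is a valid
    witness. *)
Lemma omega_bound_upper c g n m :
  (forall x, (c <= x)%N -> G x) -> (forall i, g <= gen i)%N ->
  (0 < m)%N -> (n + c <= m * g)%N -> omega_bound gen G n m.
Proof.
move=> Gc g_min m_gt0 le_mg; split=> // a _ /ltnW /subvector_of_length.
case=> b le_ba b_m; exists b; split=> //; last by rewrite b_m.
apply: (diff_in_large c) => //; apply: leq_trans le_mg _.
by rewrite -b_m vsum_geq.
Qed.

Lemma omega_estimate (R : realType) c i n :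
  (forall x, (c <= x)%N -> G x) -> (0 < gen i)%N ->
  (forall j, gen i <= gen j)%N -> (0 < n)%N ->
  exists w, [/\ omega gen G R n = (w%:R)%:E, (n <= w * gen i)%N
              & (w * gen i <= n + c + gen i)%N].
Proof.
move=> Gc gi_gt0 gi_min n_gt0.
pose m := ((n + c) %/ gen i).+1.
have m_bound : omega_bound gen G n m.
  by apply: (omega_bound_upper c (gen i)) => //; rewrite ltnW // ltn_ceil.
rewrite /omega eqn0Ngt n_gt0 /=; case: pselect => [ex|[]]; last first.
  by exists m; apply/asboolP.
case: ex_minnP => w /asboolP w_bound w_min; exists w; split=> //.
  exact: omega_bound_lower Gc gi_gt0 w_bound.
have le_wm : (w <= m)%N by apply: w_min; apply/asboolP.
apply: (@leq_trans (m * gen i)); first by rewrite leq_mul2r le_wm orbT.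
by rewrite mulSn addnC leq_add2r leq_trunc_div.
Qed.

End OmegaBound.

Theorem corollary3p9 (R : realType) (k : nat) (gen : 'I_k.+1 -> nat)
    (G : set nat)
    (G_num : numerical_monoid G)
    (G_gen : generated_by gen G)
    (gen_min : range gen = [set u | irreducible_in G u])
    (gen_incr : forall i j : 'I_k.+1, (i < j)%N -> (gen i < gen j)%N) :
  omega gen G R n / n%:R%:E @[n --> within G \oo]
    --> ((gen ord0)%:R^-1)%:E.
Proof.
have [_ /cofinite_nat_bound [c Gc]] := G_num.
set g := gen ord0.
have g_gt0 : (0 < g)%N.
  have [_ + _] : irreducible_in G g.
    by have : range gen g by [exists ord0]; rewrite gen_min.
  by rewrite lt0n => /eqP.
have g_min j : (g <= gen j)%N.
  have [->//|j_gt0] := eqVneq j ord0.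
  by apply/ltnW/gen_incr; rewrite lt0n.
have gR_gt0 : (0 < g%:R :> R)%R by rewrite ltr0n.
(* The estimate holds for every positive n, in G or not, so the limit exists
   along all of nat and is inherited by the restriction to G. *)
apply: cvg_trans; first by apply: cvg_app; exact: cvg_within.
pose C : R := ((c + g)%:R / g%:R)%R.
apply: (@squeeze_cvge _ _ _ _ (fun=> (g%:R^-1)%:E) _
  (fun n : nat => (g%:R^-1 + C * n%:R^-1)%:E)).
- near=> n.
  have n_gt0 : (0 < n)%N by near: n; exact: nbhs_infty_gt.
  have nR_gt0 : (0 < n%:R :> R)%R by rewrite ltr0n.
  have [w [-> le_n le_w]] :=
    omega_estimate k.+1 gen G R c ord0 n Gc g_gt0 g_min n_gt0.
  rewrite inver gt_eqF // -EFinM !lee_fin; apply/andP; split.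
    by rewrite ler_pdivlMr // ler_pdivrMl // mulrC -natrM ler_nat.
  rewrite ler_pdivrMr // mulrDl mulfVK ?gt_eqF // /C.
  by rewrite -(ler_pM2r gR_gt0) mulrDl mulrAC mulVf ?gt_eqF // mul1r
    mulfVK ?gt_eqF // -natrM -natrD ler_nat addnA.
- exact: cvg_cst.
- apply: cvg_EFin; first by near=> n.
  rewrite -[X in _ --> X]addr0 -[X in (_ + X)%R](mulr0 C).
  apply: cvgD; first exact: cvg_cst.
  apply: cvgMr.
  apply/gtr0_cvgV0; last exact: cvgr_idn.
  by near=> n; rewrite ltr0n; near: n; exact: nbhs_infty_gt.
Unshelve. all: by end_near. Qed.
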